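(* Let $Q,R$ be finite quandles. Then $$\eta_{Q\sqcup R}(t)=\eta_Q(t)\cdot\eta_R(t)$$ in $\mathbb{Z}[[t]]$.
   Context: A quandle is a set $Q$ with a binary operation $(x,y)\mapsto {}^{x}y$ such that (Q1) ${}^{x}x=x$ for all $x$; (Q2) for every $x$ the map $\varphi_x\colon Q\to Q$, $\varphi_x(y)={}^{x}y$, is a bijection; (Q3) ${}^{x}({}^{y}z)={}^{({}^{x}y)}({}^{x}z)$ for all $x,y,z$. The disjoint union $Q\sqcup R$ of quandles is a quandle with ${}^{x}y$ given by the operation of $Q$ if $x,y\in Q$, by the operation of $R$ if $x,y\in R$, and ${}^{x}y=y$ if $x,y$ lie in different summands. The enveloping monoid of $Q$ is the monoid $\mathscr{A}_Q$ generated by the set $Q$ with relations $x\cdot y={}^{x}y\cdot x$ for all $x,y\in Q$; it is graded over $\mathbb{N}$ with every generator $x\in Q$ of degree $1$, and $\mathscr{A}_{Q,n}$ denotes its degree-$n$ part (finite if $Q$ is finite). The generating function of a finite quandle $Q$ is $\eta_Q(t)=\sum_{n=0}^\infty|\mathscr{A}_{Q,n}|\,t^n\in\mathbb{Z}[[t]]$. *)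

(* Defs.v *)
From HB Require Import structures.
From mathcomp Require Import all_boot all_order all_algebra.
From mathcomp Require Import finmap.
From mathcomp Require Import boolp classical_sets cardinality.

Set Implicit Arguments.
Unset Strict Implicit.
Unset Printing Implicit Defensive.

Import GRing.Theory.

(* [qop x y] is the left action ^x y. *)
HB.mixin Record isQuandle (Q : Type) := {
  qop : Q -> Q -> Q;
  qop_idem : forall x, qop x x = x;
  qop_bij : forall x, bijective (qop x);
  qop_dist : forall x y z, qop x (qop y z) = qop (qop x y) (qop x z)
}.

#[short(type="quandleType")]
HB.structure Definition Quandle := {Q of isQuandle Q & Choice Q}.

#[short(type="finQuandleType")]
HB.structure Definition FinQuandle := {Q of isQuandle Q & Finite Q}.

Section DisjointUnion.
Variables Q R : quandleType.

Definition sum_qop (u v : Q + R) : Q + R :=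
  match u, v with
  | inl x, inl y => inl (qop x y)
  | inr x, inr y => inr (qop x y)
  | _, _ => v
  end.

Lemma sum_qop_idem u : sum_qop u u = u.
Proof. by case: u => x /=; rewrite qop_idem. Qed.

Lemma sum_qop_bij u : bijective (sum_qop u).
Proof.
case: u => x; have [g gK Kg] := qop_bij x.
- exists (fun v => if v is inl y then inl (g y) else v).
  + by case=> y //=; rewrite gK.
  + by case=> y //=; rewrite Kg.
- exists (fun v => if v is inr y then inr (g y) else v).
  + by case=> y //=; rewrite gK.
  + by case=> y //=; rewrite Kg.
Qed.

Lemma sum_qop_dist u v w :
  sum_qop u (sum_qop v w) = sum_qop (sum_qop u v) (sum_qop u w).
Proof. by case: u v w => x [] y [] z //=; rewrite qop_dist. Qed.

HB.instance Definition _ :=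
  isQuandle.Build (Q + R)%type sum_qop_idem sum_qop_bij sum_qop_dist.

End DisjointUnion.

HB.instance Definition _ (Q R : finQuandleType) :=
  Quandle.on (Q + R)%type.

Section EnvelopingMonoid.
Variable Q : quandleType.

(* The monoid congruence on the free monoid [seq Q] generated by
   x . y ~ ^x y . x *)
Inductive env_cong : seq Q -> seq Q -> Prop :=
| env_cong_gen x y : env_cong [:: x; y] [:: qop x y; x]
| env_cong_refl s : env_cong s s
| env_cong_sym s t : env_cong s t -> env_cong t s
| env_cong_trans s t u : env_cong s t -> env_cong t u -> env_cong s u
| env_cong_cat s t s' t' :
    env_cong s t -> env_cong s' t' -> env_cong (s ++ s') (t ++ t').

Definition env_congb (s t : seq Q) : bool := `[< env_cong s t >].

Lemma env_congb_refl : reflexive env_congb.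
Proof. by move=> s; apply/asboolP; exact: env_cong_refl. Qed.

Lemma env_congb_sym : symmetric env_congb.
Proof. by move=> s t; apply/asboolP/asboolP; exact: env_cong_sym. Qed.

Lemma env_congb_trans : transitive env_congb.
Proof.
by move=> t s u /asboolP st /asboolP tu; apply/asboolP; exact: env_cong_trans tu.
Qed.

Canonical env_congb_equiv :=
  EquivRel env_congb env_congb_refl env_congb_sym env_congb_trans.

Local Open Scope quotient_scope.

Definition env := {eq_quot env_congb}.

HB.instance Definition _ := Choice.on env.
HB.instance Definition _ := Quotient.on env.

Definition env_word (s : seq Q) : env := \pi_env s.

Lemma env_wordP s t : env_word s = env_word t <-> env_cong s t.
Proof. by split=> [/eqmodP/asboolP|st]; last exact/eqmodP/asboolP. Qed.

Lemma env_repr s : env_cong (repr (env_word s)) s.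
Proof. by apply/env_wordP; rewrite /env_word reprK. Qed.

Lemma env_ind (P : env -> Prop) : (forall s, P (env_word s)) -> forall a, P a.
Proof. by move=> Pw a; rewrite -[a]reprK; exact: Pw. Qed.

Definition env_one : env := env_word [::].
Definition env_mul (a b : env) : env := env_word (repr a ++ repr b).

Lemma env_mul_word s t : env_mul (env_word s) (env_word t) = env_word (s ++ t).
Proof. by apply/env_wordP/env_cong_cat; exact: env_repr. Qed.

Lemma env_mulA : associative env_mul.
Proof.
elim/env_ind=> s; elim/env_ind=> t; elim/env_ind=> u.
by rewrite !env_mul_word catA.
Qed.

Lemma env_mul1 : left_id env_one env_mul.
Proof. by elim/env_ind=> s; rewrite env_mul_word. Qed.

Lemma env_mulr1 : right_id env_one env_mul.
Proof. by elim/env_ind=> s; rewrite env_mul_word cats0. Qed.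

HB.instance Definition _ := isMonoid.Build env env_mulA env_mul1 env_mulr1.

Definition env_gen (x : Q) : env := env_word [:: x].

Lemma env_gen_rel x y :
  (env_gen x * env_gen y = env_gen (qop x y) * env_gen x)%g.
Proof.
have -> : (env_gen x * env_gen y)%g = env_word [:: x; y].
  exact: env_mul_word.
have -> : (env_gen (qop x y) * env_gen x)%g = env_word [:: qop x y; x].
  exact: env_mul_word.
by apply/env_wordP; exact: env_cong_gen.
Qed.

Lemma env_cong_size s t : env_cong s t -> size s = size t.
Proof.
elim=> {s t} // [s t u _ -> _ -> //|s t s' t' _ st _ st'].
by rewrite !size_cat st st'.
Qed.

Definition env_degree (a : env) : nat := size (repr a).

Lemma env_degree_word s : env_degree (env_word s) = size s.
Proof. exact/env_cong_size/env_repr. Qed.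

Lemma env_degree_one : env_degree 1%g = 0%N.
Proof. exact: env_degree_word. Qed.

Lemma env_degree_gen x : env_degree (env_gen x) = 1%N.
Proof. exact: env_degree_word. Qed.

Lemma env_degree_mul (a b : env) :
  env_degree (a * b)%g = (env_degree a + env_degree b)%N.
Proof.
elim/env_ind: a => s; elim/env_ind: b => t.
have -> : (env_word s * env_word t)%g = env_word (s ++ t).
  exact: env_mul_word.
by rewrite !env_degree_word size_cat.
Qed.

Definition env_part (n : nat) : set env := [set a | env_degree a = n]%classic.

End EnvelopingMonoid.

(* [fset_set] returns [fset0] on infinite sets; this rules that case out. *)
Lemma finite_env_part (Q : finQuandleType) n : finite_set (@env_part Q n).
Proof.
have -> : @env_part Q n =
    ((fun s : n.-tuple Q => env_word s) @` [set: n.-tuple Q])%classic.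
  apply/seteqP; split=> [a /= /eqP an|a /= [s _ <-]].
    by exists (Tuple an) => //; exact: reprK.
  by rewrite /env_part /= env_degree_word size_tuple.
by apply: finite_image; exact: finite_finset.
Qed.

Local Open Scope ring_scope.

(* [FPS f] is the series sum_n f(n) t^n; the record keeps the Cauchy product
   apart from the pointwise product of functions. *)
Record fps (R : Type) := FPS { fps_coef : nat -> R }.

HB.instance Definition _ (R : Type) := gen_eqMixin (fps R).
HB.instance Definition _ (R : Type) := gen_choiceMixin (fps R).

Lemma fpsP (R : Type) (f g : fps R) : fps_coef f =1 fps_coef g <-> f = g.
Proof.
split=> [|-> //]; case: f g => [f] [g] /= fg.
by congr FPS; apply/funext.
Qed.

Section FormalPowerSeriesRing.
Variable R : comNzRingType.
Implicit Types f g h : fps R.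

Definition fps_zero : fps R := FPS (fun=> 0).
Definition fps_opp f : fps R := FPS (fun n => - fps_coef f n).
Definition fps_add f g : fps R := FPS (fun n => fps_coef f n + fps_coef g n).
Definition fps_one : fps R := FPS (fun n => (n == 0%N)%:R).
Definition fps_mul f g : fps R :=
  FPS (fun n => \sum_(i < n.+1) fps_coef f i * fps_coef g (n - i)%N).

Lemma fps_addA : associative fps_add.
Proof. by move=> f g h; apply/fpsP => n /=; rewrite addrA. Qed.

Lemma fps_addC : commutative fps_add.
Proof. by move=> f g; apply/fpsP => n /=; rewrite addrC. Qed.

Lemma fps_add0 : left_id fps_zero fps_add.
Proof. by move=> f; apply/fpsP => n /=; rewrite add0r. Qed.

Lemma fps_addN : left_inverse fps_zero fps_opp fps_add.
Proof. by move=> f; apply/fpsP => n /=; rewrite addNr. Qed.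

HB.instance Definition _ :=
  GRing.isZmodule.Build (fps R) fps_addA fps_addC fps_add0 fps_addN.

Definition fps_trunc (N : nat) f : {poly R} := \poly_(i < N) fps_coef f i.

Lemma fps_trunc_mul N n f g : (n < N)%N ->
  (fps_trunc N f * fps_trunc N g)`_n = fps_coef (fps_mul f g) n.
Proof.
move=> nN; rewrite coefM /=; apply: eq_bigr => i _; rewrite !coef_poly.
by rewrite (leq_ltn_trans _ nN) ?leq_ord // (leq_ltn_trans _ nN) ?leq_subr.
Qed.

Lemma fps_mulC : commutative fps_mul.
Proof.
move=> f g; apply/fpsP => n.
by rewrite -!(@fps_trunc_mul n.+1) // mulrC.
Qed.

Lemma fps_mulA : associative fps_mul.
Proof.
move=> f g h; apply/fpsP => n; rewrite -!(@fps_trunc_mul n.+1) //.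
have truncM u v (p : {poly R}) :
    (fps_trunc n.+1 (fps_mul u v) * p)`_n =
    (fps_trunc n.+1 u * fps_trunc n.+1 v * p)`_n.
  rewrite !coefM; apply: eq_bigr => i _; congr (_ * _).
  by rewrite coef_poly ltn_ord fps_trunc_mul.
by rewrite truncM mulrC truncM mulrC mulrA.
Qed.

Lemma fps_mul1 : left_id fps_one fps_mul.
Proof.
move=> f; apply/fpsP => n /=.
rewrite big_ord_recl /= mul1r subn0 big1 ?addr0 // => i _.
by rewrite mul0r.
Qed.

Lemma fps_mulDl : left_distributive fps_mul (+%R).
Proof.
move=> f g h; apply/fpsP => n /=; rewrite -big_split /=.
by apply: eq_bigr => i _; rewrite mulrDl.
Qed.

Lemma fps_oner_neq0 : fps_one != 0.
Proof.
apply/eqP => /fpsP/(_ 0%N) /= /eqP.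
by rewrite oner_eq0.
Qed.

HB.instance Definition _ :=
  GRing.Zmodule_isComNzRing.Build (fps R)
    fps_mulA fps_mulC fps_mul1 fps_mulDl fps_oner_neq0.

Lemma fps_coefM f g n :
  fps_coef (f * g) n = \sum_(i < n.+1) fps_coef f i * fps_coef g (n - i)%N.
Proof. by []. Qed.

End FormalPowerSeriesRing.

Definition eta (Q : finQuandleType) : fps int :=
  FPS (fun n => (#|` fset_set (@env_part Q n)|)%:Z).

(* Main.v *)
(* Generators from different summands commute in the enveloping monoid of the
   disjoint union, so every word can be sorted into a word over Q followed by a
   word over R.  Conversely, deleting the letters of one summand respects the
   defining relations, so the two sorted factors are determined up to
   congruence.  Hence concatenation is a degree-preserving bijection from
   A_Q x A_R onto A_(Q + R). *)

Require Import Defs.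
From mathcomp Require Import all_boot all_order all_algebra.
From mathcomp Require Import finmap.
From mathcomp Require Import classical_sets cardinality.

Set Implicit Arguments.
Unset Strict Implicit.
Unset Printing Implicit Defensive.

Import GRing.Theory.

Section SumWords.
Variables A B : Type.

Definition lefts (s : seq (A + B)) : seq A :=
  pmap (fun u => if u is inl x then Some x else None) s.

Definition rights (s : seq (A + B)) : seq B :=
  pmap (fun u => if u is inr y then Some y else None) s.

Definition sum_word (s : seq A) (t : seq B) : seq (A + B) :=
  map inl s ++ map inr t.

Lemma lefts_sum_word s t : lefts (sum_word s t) = s.
Proof.
rewrite /lefts /sum_word pmap_cat map_pK; last by [].
by elim: t => [|y t IHt] /=; [rewrite cats0 | exact: IHt].
Qed.

Lemma rights_sum_word s t : rights (sum_word s t) = t.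
Proof.
by elim: s => [|x s IHs] //=; rewrite /rights /sum_word /= map_pK.
Qed.

End SumWords.

Section EnvSum.
Variables Q R : quandleType.
Implicit Types (s : seq (Q + R)%type) (a : env Q) (b : env R).

(** A relation between two letters of [Q] is kept, one between two letters of [R] collapses to the
    empty word, and a mixed one leaves the same single letter on both sides, since letters of
    different summands act trivially on each other. *)
Lemma lefts_cong s s' : env_cong s s' -> env_cong (lefts s) (lefts s').
Proof.
elim=> {s s'} [[x|x] [y|y]|s|s t _|s t u _ st _|s t s' t' _ st _ st'] /=;
  try exact: env_cong_refl.
- exact: env_cong_gen.
- exact: env_cong_sym.
- exact: env_cong_trans.
- by rewrite /lefts !pmap_cat; exact: env_cong_cat.
Qed.

Lemma rights_cong s s' : env_cong s s' -> env_cong (rights s) (rights s').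
Proof.
elim=> {s s'} [[x|x] [y|y]|s|s t _|s t u _ st _|s t s' t' _ st _ st'] /=;
  try exact: env_cong_refl.
- exact: env_cong_gen.
- exact: env_cong_sym.
- exact: env_cong_trans.
- by rewrite /rights !pmap_cat; exact: env_cong_cat.
Qed.

Lemma map_inl_cong (s t : seq Q) :
  env_cong s t -> env_cong (map (@inl Q R) s) (map inl t).
Proof.
elim=> {s t} [x y|s|s t _|s t u _ st _|s t s' t' _ st _ st'] /=.
- exact: (env_cong_gen (inl x : (Q + R)%type) (inl y)).
- exact: env_cong_refl.
- exact: env_cong_sym.
- exact: env_cong_trans.
- by rewrite !map_cat; exact: env_cong_cat.
Qed.

Lemma map_inr_cong (s t : seq R) :
  env_cong s t -> env_cong (map (@inr Q R) s) (map inr t).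
Proof.
elim=> {s t} [x y|s|s t _|s t u _ st _|s t s' t' _ st _ st'] /=.
- exact: (env_cong_gen (inr x : (Q + R)%type) (inr y)).
- exact: env_cong_refl.
- exact: env_cong_sym.
- exact: env_cong_trans.
- by rewrite !map_cat; exact: env_cong_cat.
Qed.

Lemma sum_word_cong (s s' : seq Q) (t t' : seq R) :
  env_cong s s' -> env_cong t t' ->
  env_cong (sum_word s t) (sum_word s' t').
Proof.
by move=> ss' tt'; exact: env_cong_cat (map_inl_cong ss') (map_inr_cong tt').
Qed.

Lemma inr_map_inl_comm (y : R) (s : seq Q) :
  env_cong (inr y :: map inl s) (rcons (map inl s) (inr y) : seq (Q + R)%type).
Proof.
elim: s => [|x s IHs] /=; first exact: env_cong_refl.
apply: (@env_cong_trans _ _ (inl x :: inr y :: map inl s)).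
  (* As [qop (inr y) (inl x)] reduces to [inl x], the defining relation is here a plain swap of the
     two letters. *)
  have xy := env_cong_gen (inr y : (Q + R)%type) (inl x).
  exact: (env_cong_cat xy (env_cong_refl (map inl s))).
exact: (env_cong_cat (env_cong_refl [:: inl x]) IHs).
Qed.

Lemma sum_word_sort s : env_cong (sum_word (lefts s) (rights s)) s.
Proof.
elim: s => [|[x|y] s IHs]; first exact: env_cong_refl.
  exact: (env_cong_cat (env_cong_refl [:: inl x]) IHs).
(* Once the tail is sorted, the leading [inr y] only has to travel past the whole block of letters
   from [Q]. *)
apply: env_cong_trans (env_cong_cat (env_cong_refl [:: inr y]) IHs).
apply: env_cong_sym; rewrite /sum_word /= -cat_rcons -cat_cons.
by apply: env_cong_cat; [exact: inr_map_inl_comm | exact: env_cong_refl].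
Qed.

Definition env_join (ab : env Q * env R) : env (Q + R)%type :=
  env_word (sum_word (repr ab.1) (repr ab.2)).

Definition env_left (c : env (Q + R)%type) : env Q := env_word (lefts (repr c)).

Definition env_right (c : env (Q + R)%type) : env R :=
  env_word (rights (repr c)).

Lemma env_joinK : cancel env_join (fun c => (env_left c, env_right c)).
Proof.
case=> a b; rewrite /env_join /env_left /env_right /=.
set w := sum_word _ _; congr pair.
  (* Writing [a] as the class of its representative reduces the equality to a congruence of words;
     [lefts_cong] absorbs the change of representative of the class of [w]. *)
  rewrite -[RHS]reprK; apply/env_wordP.
  by rewrite -(lefts_sum_word (repr a) (repr b)); exact/lefts_cong/env_repr.
rewrite -[RHS]reprK; apply/env_wordP.
by rewrite -(rights_sum_word (repr a) (repr b)); exact/rights_cong/env_repr.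
Qed.

Lemma env_splitK : cancel (fun c => (env_left c, env_right c)) env_join.
Proof.
move=> c; rewrite -[RHS]reprK; apply/env_wordP => /=.
apply: env_cong_trans (sum_word_sort _).
by apply: sum_word_cong; exact: env_repr.
Qed.

Lemma env_degree_join a b :
  env_degree (env_join (a, b)) = env_degree a + env_degree b.
Proof. by rewrite env_degree_word size_cat !size_map. Qed.

End EnvSum.

Local Open Scope ring_scope.

(** The degree-[n] elements are split according to the degree [i] of their left factor; [env_join]
    identifies each fibre with a product of homogeneous parts. *)
Lemma card_env_part_sum (Q R : finQuandleType) n :
  #|` fset_set (@env_part (Q + R)%type n)| =
  (\sum_(i < n.+1) #|` fset_set (@env_part Q i)| *
                   #|` fset_set (@env_part R (n - i))|)%N.
Proof.
have mem_part (S : finQuandleType) m (a : env S) :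
    (a \in fset_set (env_part m)) = (env_degree a == m).
  rewrite in_fset_set; last exact: finite_env_part.
  by apply/idP/eqP; rewrite inE.
pose degl (c : env (Q + R)%type) := env_degree (env_left c).
set P := fset_set _.
have degl_le c : c \in P -> (degl c < n.+1)%N.
  rewrite mem_part -[c]env_splitK env_degree_join ltnS => /eqP <-.
  by rewrite env_splitK leq_addr.
(* Each [c] is counted once, at the only index [i] equal to [degl c], which is in range by
   [degl_le]. *)
have -> : #|` P| = (\sum_(c <- P) \sum_(i < n.+1 | degl c == i) 1)%N.
  rewrite -sum1_size; apply: eq_big_seq => c /degl_le cn.
  by rewrite (big_pred1 (Ordinal cn)) // => i; rewrite eq_sym.
rewrite (exchange_big_dep predT) //=; apply: eq_bigr => i _.
(* Both sides become lengths of duplicate-free lists, the fibre over [i] and the list of all joins,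
   so it suffices to compare members. *)
rewrite -(size_allpairs (fun a b => env_join (a, b))) sum1_count -size_filter.
apply/perm_size/uniq_perm; first by rewrite filter_uniq ?fset_uniq.
  apply: allpairs_uniq; rewrite ?fset_uniq // => -[a b] [a' b'] _ _ /=.
  exact: (can_inj (@env_joinK Q R)).
move=> c; rewrite mem_filter mem_part; apply/andP/allpairsP => /=.
  case=> /eqP ci /eqP cn; exists (env_left c, env_right c).
  rewrite !mem_part /= env_splitK -ci eqxx -cn -[in X in (X - _)%N](env_splitK c).
  by rewrite env_degree_join addKn.
case=> -[a b] /= []; rewrite !mem_part => /eqP ai /eqP bi ->.
have [degl_join _] := env_joinK (a, b).
(* The bound [i <= n] makes the truncated subtraction exact, so the degrees add up to [n]. *)
by rewrite /degl degl_join env_degree_join ai bi subnKC ?leq_ord.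
Qed.

Theorem proposition6p5 (Q R : finQuandleType) :
  eta (Q + R)%type = eta Q * eta R :> fps int.
Proof.
apply/fpsP => n; rewrite fps_coefM /= card_env_part_sum.
by rewrite -natz natr_sum; apply: eq_bigr => i _; rewrite natrM !natz.
Qed.
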